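(* The Fair Allocation algorithm runs in polynomial time and computes an offline fair allocation under any sharing policy in which adding an advertiser to the set of interested advertisers of an impression does not increase the share of any other advertiser. Moreover, for any sharing policy $H$, this algorithm produces the most efficient allocation among all fair allocations under $H$.
   Context: Display ad instance: a set $I$ of $n$ impressions and a set $J$ of advertisers; advertiser $j$ has an integer demand $n(j)$ and each pair has a weight $w_{ij}\ge0$; each advertiser $j$ has a preference order on impressions by nonincreasing $w_{ij}$. A (fractional) allocation is $x=(x_{ij})$ with $x_{ij}\ge0$; its efficiency is $\sum_{i,j}w_{ij}x_{ij}$. A sharing policy $H$ maps an impression $i$ and the set $J(i)$ of advertisers interested in it to a fractional allocation $\{x_{ij}\}_{j\in J(i)}$ of $i$ (e.g. equal sharing: $x_{ij}=1/|J(i)|$). Given $H$, an allocation $x^*$ is fair under $H$ if each advertiser $j$ is interested in a set of impressions that is a prefix of its preference order; $x^*$ is obtained by applying $H$ to each impression with $J(i)$ the set of advertisers interested in $i$; and each advertiser is either interested in all impressions or receives at least $n(j)$ impressions in total under $x^*$ (i.e. $\sum_i x^*_{ij}\ge n(j)$). Fair Allocation algorithm: maintain $x_{ij}$ and pointers $p(j)$, all initialized to $0$. While some advertiser $j$ is unsatisfied (i.e. $\sum_i x_{ij}<n(j)$ and $p(j)<n$): pick such $j$, increase $p(j)$ by one, let $i$ be the $p(j)$-th best impression in $j$'s preference order, let $J(i)$ be the set of advertisers $j'$ for which $i$ is among their first $p(j')$ impressions, and set $x_{ij'}$ for all $j'\in J(i)$ according to $H$.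
   Formalization: The efficiency claim is false as stated: it is proved with only impressions up to the demand n(j) counted for each advertiser (over-delivery earns nothing), and only for policies H where adding an advertiser increases no other's share. Time is unit-cost, H an oracle. *)

(* Defs.v *)
From HB Require Import structures.
From mathcomp Require Import all_boot all_order all_algebra.

Set Implicit Arguments.
Unset Strict Implicit.
Unset Printing Implicit Defensive.

Import Order.TTheory GRing.Theory Num.Theory.
Local Open Scope ring_scope.

(* [pref j] lists all impressions, best first; it fixes how ties between equal
   weights are broken. *)
Record instance (R : realFieldType) (I J : finType) := Instance {
  demand : J -> nat;
  weight : I -> J -> R;
  pref : J -> seq I;
  weight_ge0 : forall i j, 0 <= weight i j;
  pref_perm : forall j, perm_eq (pref j) (enum I);
  pref_sorted : forall j, sorted (fun i k => weight k j <= weight i j) (pref j)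
}.

(* [share i S j] is the fraction of impression i given to j when S is the set
   of advertisers interested in i; it is meaningful, and used, only for
   j \in S. *)
Record policy (R : realFieldType) (I J : finType) := Policy {
  share :> I -> {set J} -> J -> R;
  share_ge0 : forall i (S : {set J}) j, j \in S -> 0 <= share i S j
}.

Definition nonincreasing_policy (R : realFieldType) (I J : finType)
    (H : policy R I J) : Prop :=
  forall i (S : {set J}) j k,
    j \in S -> k \notin S -> H i (k |: S) j <= H i S j.

Section Allocations.
Variables (R : realFieldType) (I J : finType).
Variables (D : instance R I J) (H : policy R I J).

Definition efficiency (x : I -> J -> R) : R :=
  \sum_i \sum_j weight D i j * x i j.

Definition interested (S : J -> {set I}) (i : I) : {set J} :=
  [set j | i \in S j].

Definition fair (x : I -> J -> R) : Prop :=
  exists S : J -> {set I},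
    [/\ forall j, exists k : nat, S j = [set i in take k (pref D j)],
        forall i j, x i j =
          if j \in interested S i then H i (interested S i) j else 0
      & forall j, S j = [set: I] \/ (demand D j)%:R <= \sum_i x i j].

(* A fair allocation may give j more than its demand n(j). The impressions of x
   that count are a part y of x that gives each j at most n(j), which is the
   demand constraint of the display ad allocation problem. Pitfall: if the
   excess counted too, a needlessly long prefix would win. With one advertiser
   of demand 1 and two impressions of weight 1, both the prefix of length 1
   and that of length 2 are fair, and efficiency would be 1 and 2. *)
Definition delivery (x y : I -> J -> R) : Prop :=
  (forall i j, 0 <= y i j <= x i j) /\
  (forall j, \sum_i y i j <= (demand D j)%:R).

Definition most_efficient (x : I -> J -> R) : Prop :=
  exists2 y, delivery x y &
    forall x' y', fair x' -> delivery x' y' -> efficiency y' <= efficiency y.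

End Allocations.

(* A computation returns its running time together with its result. Arithmetic
   operations, comparisons, memory accesses and evaluations of the sharing
   policy take one unit each. *)
Definition timed (A : Type) : Type := (nat * A)%type.

Definition ret (A : Type) (a : A) : timed A := (0%N, a).

Definition tick (A : Type) (a : A) : timed A := (1%N, a).

Definition bind (A B : Type) (m : timed A) (f : A -> timed B) : timed B :=
  ((m.1 + (f m.2).1)%N, (f m.2).2).

Notation "'let!' a ':=' m 'in' e" := (bind m (fun a => e))
  (at level 200, a name, m at level 100, e at level 200).

Fixpoint for_each (T A : Type) (s : seq T) (f : T -> A -> timed A) (a : A) :
    timed A :=
  if s is z :: s' then let! b := f z a in for_each s' f b else ret a.

Section Algorithm.
Variables (R : realFieldType) (I J : finType).
Variables (D : instance R I J) (H : policy R I J).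

Record state := State { alloc : I -> J -> R; ptr : J -> nat }.

Definition initialize : timed state :=
  ((#|I| * #|J| + #|J|)%N, State (fun _ _ => 0) (fun _ => 0%N)).

Definition received (s : state) (j : J) : timed R :=
  for_each (enum I) (fun i r => tick (r + alloc s i j)) 0.

Definition unsatisfied (s : state) (j : J) : timed bool :=
  let! r := received s j in
  let! short := tick (r < (demand D j)%:R) in
  let! more := tick (ptr s j < #|I|)%N in
  tick (short && more).

Definition all_unsatisfied (s : state) : timed (seq J) :=
  for_each (enum J)
    (fun j us =>
       let! u := unsatisfied s j in
       tick (if u then j :: us else us)) [::].

Definition wants (p : J -> nat) (i : I) (j : J) : timed bool :=
  for_each (take (p j) (pref D j)) (fun k b => tick (b || (k == i))) false.

Definition interested_set (p : J -> nat) (i : I) : timed {set J} :=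
  for_each (enum J)
    (fun j S => let! b := wants p i j in tick (if b then j |: S else S)) set0.

Definition set_alloc (x : I -> J -> R) (i : I) (j : J) (r : R) :
    I -> J -> R :=
  fun i' j' => if (i' == i) && (j' == j) then r else x i' j'.

(* [onth] counts from 0, so the impression at position p(j) is the one reached
   by the pointer after p(j) is increased. *)
Definition advance (s : state) (j : J) : timed state :=
  let! p := tick (fun j' => if j' == j then (ptr s j).+1 else ptr s j') in
  let! oi := tick (onth (pref D j) (ptr s j)) in
  if oi is Some i then
    let! S := interested_set p i in
    let! h := tick (H i S) in
    let! x := for_each (enum S)
                (fun j' x => tick (set_alloc x i j' (h j'))) (alloc s) in
    ret (State x p)
  else ret (State (alloc s) p).

(* [exec t s]: some execution is in state s at the loop head at time t. The
   choice of the unsatisfied advertiser is arbitrary in each iteration. *)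
Inductive exec : nat -> state -> Prop :=
| exec_init : exec initialize.1 initialize.2
| exec_iter t s j :
    exec t s -> j \in (all_unsatisfied s).2 ->
    exec (t + (all_unsatisfied s).1 + (advance s j).1)%N (advance s j).2.

Inductive returns : nat -> (I -> J -> R) -> Prop :=
| returns_alloc t s :
    exec t s -> (all_unsatisfied s).2 = [::] ->
    returns (t + (all_unsatisfied s).1)%N (alloc s).

End Algorithm.

(* Main.v *)
Require Import Defs.
From HB Require Import structures.
From mathcomp Require Import all_boot all_order all_algebra.
From mathcomp Require Import zify.

Set Implicit Arguments.
Unset Strict Implicit.
Unset Printing Implicit Defensive.

(** Every prefix that the algorithm has reached is contained in the
    corresponding prefix of every fair allocation: if an advertiser is
    unsatisfied with its current prefix, then by monotonicity of the policy it
    would receive no more from that same prefix when the other prefixes are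
    longer.  So the final allocation has the shortest prefixes, and on these it
    gives each advertiser at least as much of every impression as any other
    fair allocation.  Filling each demand greedily in preference order then
    dominates every other delivery in all partial sums, and Abel summation
    against the nonincreasing weights turns this into efficiency.  Each
    iteration advances one of the #|J| pointers, each at most #|I| times. *)

Import Order.TTheory GRing.Theory Num.Theory.

(** * Results and costs of timed loops *)

Section TimedLoops.
Variables (T A : Type).

Lemma for_each_result (s : seq T) (f : T -> A -> timed A) (a : A) :
  (for_each s f a).2 = foldl (fun b z => (f z b).2) a s.
Proof. by elim: s a => //= z s IHs a; rewrite IHs. Qed.

Lemma for_each_time (s : seq T) (f : T -> A -> timed A) (c : nat) (a : A) :
  (forall z b, (f z b).1 <= c) -> (for_each s f a).1 <= size s * c.
Proof.
move=> f_le; elim: s a => //= z s IHs a.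
by rewrite mulSn leq_add.
Qed.

End TimedLoops.

(** * Folds, prefix sums and Abel summation *)

Section FiniteSequences.
Local Open Scope ring_scope.

Lemma foldl_addr (V : nmodType) (T : Type) (s : seq T) (f : T -> V) (a : V) :
  foldl (fun b z => b + f z) a s = a + \sum_(z <- s) f z.
Proof.
elim: s a => [|z s IHs] a /=; first by rewrite big_nil addr0.
by rewrite IHs big_cons addrA.
Qed.

Lemma foldl_has (T : Type) (s : seq T) (P : pred T) (b : bool) :
  foldl (fun b z => b || P z) b s = b || has P s.
Proof. by elim: s b => [|z s IHs] b /=; rewrite ?orbF // IHs orbA. Qed.

Lemma mem_foldl_cons (T : eqType) (s : seq T) (P : pred T) (a : seq T) (z : T) :
  (z \in foldl (fun b y => if P y then y :: b else b) a s) =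
  (z \in a) || (z \in s) && P z.
Proof.
elim: s a => [|y s IHs] a /=; first by rewrite orbF.
rewrite IHs in_cons; case: ifP => Py.
  by rewrite in_cons; case: eqP => [->|] //=; rewrite Py orbT.
by case: eqP => [->|] //=; rewrite Py andbF.
Qed.

Lemma in_foldl_setU1 (T : finType) (s : seq T) (P : pred T) (A : {set T})
    (z : T) :
  (z \in foldl (fun B y => if P y then y |: B else B) A s) =
  (z \in A) || (z \in s) && P z.
Proof.
elim: s A => [|y s IHs] A /=; first by rewrite orbF.
rewrite IHs in_cons; case: ifP => Py.
  by rewrite in_setU1; case: eqP => [->|] //=; rewrite Py orbT.
by case: eqP => [->|] //=; rewrite Py andbF.
Qed.

Lemma ler_sum_take (R : numDomainType) (T : Type) (s : seq T) (f : T -> R)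
    (k l : nat) :
  (forall z, 0 <= f z) -> (k <= l)%N ->
  \sum_(z <- take k s) f z <= \sum_(z <- take l s) f z.
Proof.
move=> f_ge0 le_kl; rewrite -(cat_take_drop k (take l s)) big_cat /=.
by rewrite take_takel // lerDl sumr_ge0.
Qed.

(* Abel summation; the lower bound [lam] makes the induction on the last
   element go through, with the weight of that element as the next [lam]. *)
Lemma sum_weighted_prefix_ge (R : numDomainType) (T : eqType) (s : seq T)
    (w d : T -> R) (lam : R) :
  sorted (fun y z => w z <= w y) s -> 0 <= lam ->
  {in s, forall z, lam <= w z} ->
  (forall k, 0 <= \sum_(z <- take k s) d z) ->
  lam * (\sum_(z <- s) d z) <= \sum_(z <- s) w z * d z.
Proof.
elim/last_ind: s lam => [|s z IHs] lam.
  by move=> *; rewrite !big_nil mulr0.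
move=> s_sorted lam_ge0 le_lam d_ge0.
have le_lam_z : lam <= w z by rewrite le_lam // mem_rcons mem_head.
have tr : transitive (fun y z => w z <= w y).
  by move=> a b c le_ab le_bc; apply: le_trans le_bc le_ab.
have := s_sorted; rewrite -cats1 sorted_pairwise // pairwise_cat allrel1r.
rewrite -sorted_pairwise // => /and3P[/allP ge_z s_srt _].
have d_total : 0 <= \sum_(y <- s ++ [:: z]) d y.
  by have := d_ge0 (size (rcons s z)); rewrite take_size -cats1.
apply: le_trans (ler_wpM2r d_total le_lam_z) _.
rewrite !big_cat !big_seq1 /= mulrDr lerD2r; apply: IHs => //.
- exact: le_trans le_lam_z.
- move=> k; case: (leqP k (size s)) => [le_ks|/ltnW le_sk].
    by have := d_ge0 k; rewrite -cats1 takel_cat.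
  by have := d_ge0 (size s); rewrite -cats1 take_size_cat // take_oversize.
Qed.

Lemma ler_sum_weighted_prefix (R : numDomainType) (T : eqType) (s : seq T)
    (w f g : T -> R) :
  sorted (fun y z => w z <= w y) s -> (forall z, 0 <= w z) ->
  (forall k, \sum_(z <- take k s) f z <= \sum_(z <- take k s) g z) ->
  \sum_(z <- s) w z * f z <= \sum_(z <- s) w z * g z.
Proof.
move=> s_sorted w_ge0 le_fg.
rewrite -subr_ge0 -sumrB; under eq_bigr do rewrite -mulrBr.
(* Abel summation is applied to [g - f] with the lower bound [lam := 0] on the weights. *)
rewrite -[leLHS](mul0r (\sum_(z <- s) (g z - f z))).
by apply: sum_weighted_prefix_ge => // k; rewrite sumrB subr_ge0.
Qed.

End FiniteSequences.

(** * Spending a budget along a sequence *)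

Section Greedy.
Local Open Scope ring_scope.
Variables (R : realDomainType) (T : eqType) (s : seq T) (b : R) (f : T -> R).
Hypotheses (s_uniq : uniq s) (b_ge0 : 0 <= b) (f_ge0 : forall z, 0 <= f z).

(* The part of [f z] taken when the budget [b] is spent along [s]. *)
Definition greedy (z : T) : R :=
  Num.min b (\sum_(y <- take (index z s).+1 s) f y) -
  Num.min b (\sum_(y <- take (index z s) s) f y).

Lemma greedy_ge0 z : 0 <= greedy z.
Proof.
rewrite subr_ge0 le_min !ge_min lexx /=.
by rewrite (ler_sum_take _ f_ge0 (leqnSn _)) orbT.
Qed.

Lemma greedy_le z : greedy z <= f z.
Proof.
rewrite /greedy; case: (ltnP (index z s) (size s)) => z_s; last first.
  (* Outside [s] the index is [size s], so both prefixes are all of [s] and [greedy] is 0. *)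
  by rewrite !take_oversize ?subrr // ltnW.
rewrite (take_nth z) // -cats1 big_cat big_seq1 /= nth_index -?index_mem //.
have fz := f_ge0 z; set X := \sum_(y <- _) _.
rewrite lerBlDl; case: (lerP b X) => bX.
  by rewrite ge_min lerDl fz.
by rewrite ge_min lexx orbT.
Qed.

(** The differences telescope; uniqueness of [s] ensures that the entry at position k has index
    k. *)
Lemma sum_greedy_take k :
  \sum_(z <- take k s) greedy z = Num.min b (\sum_(z <- take k s) f z).
Proof.
elim: k => [|k IHk]; first by rewrite take0 !big_nil min_r.
case: (ltnP k (size s)) => k_s; last first.
  by rewrite take_oversize ?leqW // -{1 2}(take_oversize k_s).
have [x0 _] : exists x0 : T, true by case: s k_s => // x0; exists x0.
rewrite {1}(take_nth x0) // -cats1 big_cat big_seq1 /= IHk.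
by rewrite /greedy index_uniq // addrC subrK.
Qed.

End Greedy.

(** * Allocations induced by prefixes, and their monotonicity *)

Section FairAllocation.
Local Open Scope ring_scope.
Variables (R : realFieldType) (I J : finType).
Variables (D : instance R I J) (H : policy R I J).
Hypothesis H_mono : nonincreasing_policy H.

Definition prefix_set (p : J -> nat) (j : J) : {set I} :=
  [set i in take (p j) (pref D j)].

Definition policy_alloc (S : J -> {set I}) (i : I) (j : J) : R :=
  if j \in interested S i then H i (interested S i) j else 0.

Lemma size_pref j : size (pref D j) = #|I|.
Proof. by rewrite (perm_size (pref_perm D j)) -cardE. Qed.

Lemma mem_pref j i : i \in pref D j.
Proof. by rewrite (perm_mem (pref_perm D j)) mem_enum. Qed.

Lemma uniq_pref j : uniq (pref D j).
Proof. by rewrite (perm_uniq (pref_perm D j)) enum_uniq. Qed.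

Lemma sum_pref j (f : I -> R) : \sum_i f i = \sum_(i <- pref D j) f i.
Proof. by rewrite (perm_big _ (pref_perm D j)) big_enum. Qed.

Lemma policy_alloc_ge0 S i j : 0 <= policy_alloc S i j.
Proof. by rewrite /policy_alloc; case: ifP => // /share_ge0. Qed.

(** The elements of [B :\: A] are added one at a time, each step being an instance of [H_mono]. *)
Lemma share_subset i (A B : {set J}) j :
  A \subset B -> j \in A -> H i B j <= H i A j.
Proof.
move=> sAB jA; have [n] := ubnP #|B :\: A|.
elim: n A sAB jA => // n IHn A sAB jA; rewrite ltnS => le_n.
have [/eqP|[k]] := set_0Vmem (B :\: A).
  rewrite setD_eq0 => sBA.
  by have -> : A = B by apply/eqP; rewrite eqEsubset sAB.
rewrite inE => /andP[kA kB].
apply: le_trans (H_mono i jA kA); apply: IHn.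
- by rewrite subUset sub1set kB.
- by rewrite in_setU1 jA orbT.
apply: leq_trans le_n; apply: proper_card; apply/properP; split.
  by apply: setDS; apply: subsetUr.
by exists k; rewrite !inE ?kA ?kB // eqxx.
Qed.

(** The second hypothesis excludes the one case where j can gain: when its own set newly acquires i.
    Otherwise j only meets more competitors, or gets 0 under [S']. *)
Lemma policy_alloc_subset (S S' : J -> {set I}) i j :
  (forall k, S k \subset S' k) -> (i \in S' j -> i \in S j) ->
  policy_alloc S' i j <= policy_alloc S i j.
Proof.
move=> sSS' iSj; rewrite {1}/policy_alloc inE.
case: ifP => [/iSj iS|_]; last exact: policy_alloc_ge0.
rewrite /policy_alloc inE iS; apply: share_subset; last by rewrite inE.
by apply/subsetP => k; rewrite !inE; apply: subsetP.
Qed.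

(** * What the loops of the algorithm compute *)

Lemma received_result (s : state R I J) j :
  (received s j).2 = \sum_i alloc s i j.
Proof.
rewrite /received for_each_result /= foldl_addr add0r big_enum //.
Qed.

Lemma unsatisfied_result (s : state R I J) j :
  (unsatisfied D s j).2 =
  (\sum_i alloc s i j < (demand D j)%:R) && (ptr s j < #|I|)%N.
Proof. by rewrite /unsatisfied /= received_result. Qed.

Lemma mem_all_unsatisfied (s : state R I J) j :
  (j \in (all_unsatisfied D s).2) =
  (\sum_i alloc s i j < (demand D j)%:R) && (ptr s j < #|I|)%N.
Proof.
rewrite /all_unsatisfied for_each_result.
rewrite (mem_foldl_cons _ (fun j => (unsatisfied D s j).2)) mem_enum.
exact: unsatisfied_result.
Qed.

Lemma wants_result p i j : (wants D p i j).2 = (i \in prefix_set p j).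
Proof. by rewrite /wants for_each_result /= foldl_has has_pred1 inE. Qed.

Lemma interested_set_result p i :
  (interested_set D p i).2 = interested (prefix_set p) i.
Proof.
apply/setP => j; rewrite /interested_set for_each_result.
rewrite (in_foldl_setU1 _ (fun j => (wants D p i j).2)) mem_enum !in_set.
by rewrite wants_result !inE.
Qed.

Lemma set_alloc_loop (s : seq J) (x : I -> J -> R) i (h : J -> R) i' j' :
  (for_each s (fun j x => tick (set_alloc x i j (h j))) x).2 i' j' =
  if (i' == i) && (j' \in s) then h j' else x i' j'.
Proof.
rewrite for_each_result; elim: s x => [|j s IHs] x /=; first by rewrite andbF.
rewrite IHs /set_alloc in_cons.
by case: (i' == i) => //=; case: eqP => [->|_] //=; case: ifP.
Qed.

(** * Cost of one iteration *)

Lemma all_unsatisfied_time (s : state R I J) :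
  ((all_unsatisfied D s).1 <= #|J| * (#|I| + 4))%N.
Proof.
rewrite [#|J|]cardE; apply: for_each_time => j us /=.
have : ((received s j).1 <= #|I| * 1)%N by rewrite [#|I|]cardE for_each_time.
by rewrite muln1 -addnA leq_add2r.
Qed.

Lemma interested_set_time p i :
  ((interested_set D p i).1 <= #|J| * (#|I| + 1))%N.
Proof.
rewrite [#|J|]cardE; apply: for_each_time => j S /=.
rewrite leq_add2r -[#|I|]muln1.
apply: leq_trans (for_each_time (c := 1%N) _ _ _) _ => //.
by rewrite leq_mul2r -(size_pref j) size_take_min geq_minr.
Qed.

Lemma advance_time (s : state R I J) j :
  ((advance D H s j).1 <= #|J| * (#|I| + 2) + 3)%N.
Proof.
set m := #|J|; set n := #|I|.
rewrite /advance /=; case: onth => [i|] /=; last by lia.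
set p := (fun _ => _).
have : ((interested_set D p i).1 <= m * (n + 1))%N by exact: interested_set_time.
set S := (interested_set D p i).2; set h := H i S.
have : ((for_each (enum S) (fun j x => tick (set_alloc x i j (h j)))
          (alloc s)).1 <= m * 1)%N.
  apply: leq_trans (for_each_time (c := 1%N) _ _ _) _ => //.
  by rewrite leq_mul2r -cardE max_card.
lia.
Qed.

(** * Effect of one iteration on pointers and allocation *)

Definition bump_ptr (p : J -> nat) (j k : J) : nat :=
  if k == j then (p j).+1 else p k.

Lemma advance_ptr (s : state R I J) j :
  ptr (advance D H s j).2 = bump_ptr (ptr s) j.
Proof. by rewrite /advance /=; case: onth. Qed.

Lemma sum_bump_ptr p j : (\sum_k bump_ptr p j k = (\sum_k p k).+1)%N.
Proof.
rewrite (bigD1 j) //= [in RHS](bigD1 j) //= /bump_ptr eqxx addSn.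
by congr (_ + _).+1; apply: eq_bigr => k /negPf->.
Qed.

Lemma prefix_set_bump p j x0 k : (p j < #|I|)%N ->
  prefix_set (bump_ptr p j) k =
  if k == j then nth x0 (pref D j) (p j) |: prefix_set p j else prefix_set p k.
Proof.
move=> p_lt; rewrite /prefix_set /bump_ptr; case: eqP => // ->.
apply/setP => i; rewrite !inE (take_nth x0) ?size_pref //.
by rewrite mem_rcons in_cons.
Qed.

Lemma prefix_set_next p j x0 : (p j < #|I|)%N ->
  nth x0 (pref D j) (p j) \notin prefix_set p j.
Proof.
rewrite -(size_pref j) => p_lt; rewrite inE.
have := uniq_pref j; rewrite -{1}(cat_take_drop (p j).+1 (pref D j)) cat_uniq.
by rewrite (take_nth x0) // rcons_uniq => /andP[/andP[]].
Qed.

(** Only the impression just reached changes its set of interested advertisers, so recomputing that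
    single row restores agreement with the policy. *)
Lemma advance_alloc (s : state R I J) j : (ptr s j < #|I|)%N ->
  (forall i k, alloc s i k = policy_alloc (prefix_set (ptr s)) i k) ->
  forall i k, alloc (advance D H s j).2 i k =
    policy_alloc (prefix_set (bump_ptr (ptr s) j)) i k.
Proof.
move=> p_lt s_alloc i k.
have [x0 _] : exists x0 : I, true.
  by move: p_lt; case: (pickP I) => [x0|/eq_card0->] //; exists x0.
rewrite /advance /= onthE (nth_map x0) ?size_pref //=.
set i0 := nth x0 (pref D j) (ptr s j).
rewrite set_alloc_loop mem_enum interested_set_result -/(bump_ptr (ptr s) j).
case: eqP => [->|/eqP i_neq] /=.
  (* The loop does not write entries outside the interested set; they were already 0, because that
     set only grows. *)
  rewrite /policy_alloc; case: ifPn => // kS; rewrite s_alloc /policy_alloc.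
  rewrite ifN // !inE; apply: contra kS; rewrite inE.
  rewrite (prefix_set_bump x0) // -/i0.
  by case: eqP => [->|_]; rewrite !inE // eqxx.
rewrite s_alloc /policy_alloc.
have -> // : interested (prefix_set (bump_ptr (ptr s) j)) i =
             interested (prefix_set (ptr s)) i.
apply/setP => l; rewrite inE [RHS]inE (prefix_set_bump x0) // -/i0.
by case: eqP => [->|_] //; rewrite in_setU1 (negPf i_neq).
Qed.

(** * Invariants, running time and termination *)

Lemma exec_ptr_le t s : exec D H t s -> forall j, (ptr s j <= #|I|)%N.
Proof.
elim=> // {}t {}s j _ IHs; rewrite mem_all_unsatisfied => /andP[_ p_lt] k.
by rewrite advance_ptr /bump_ptr; case: ifP.
Qed.

Lemma exec_alloc t s : exec D H t s ->
  forall i j, alloc s i j = policy_alloc (prefix_set (ptr s)) i j.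
Proof.
elim=> [i j|{}t {}s j _ IHs].
  by rewrite /policy_alloc !inE take0.
rewrite mem_all_unsatisfied => /andP[_ p_lt] i k.
by rewrite advance_alloc // advance_ptr.
Qed.

Lemma exec_sum_ptr t s : exec D H t s -> (\sum_j ptr s j <= #|I| * #|J|)%N.
Proof.
move=> /exec_ptr_le p_le.
rewrite mulnC -sum_nat_const; exact: leq_sum.
Qed.

(** The sum of the pointers counts the iterations; the factor adds the bounds of
    [all_unsatisfied_time] and [advance_time]. *)
Lemma exec_time t s : exec D H t s ->
  (t <= #|I| * #|J| + #|J| +
        (\sum_j ptr s j) * (#|J| * (2 * #|I| + 6) + 3))%N.
Proof.
elim=> [|{}t {}s j _ IHs _]; first by rewrite leq_addr.
rewrite advance_ptr sum_bump_ptr mulSn.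
have := all_unsatisfied_time s; have := advance_time s j.
have -> : (#|J| * (2 * #|I| + 6) + 3 =
          #|J| * (#|I| + 4) + (#|J| * (#|I| + 2) + 3))%N by lia.
lia.
Qed.

(** The extra test of all advertisers makes the bound cover [returns] too. With n, m, N as below, 12
    is 9 for the iterations plus 3 for initialization and this test, since 2nm + 5m <= 3N^2. *)
Lemma exec_poly t s : exec D H t s ->
  (t + (all_unsatisfied D s).1 <= 12 * (#|I| + #|J|).+1 ^ 4)%N.
Proof.
move=> ex; have := exec_time ex; have := exec_sum_ptr ex.
have := all_unsatisfied_time s.
move: (\sum_j _)%N (all_unsatisfied D s).1 => P u.
set n := #|I|; set m := #|J|; set N := (n + m).+1.
move=> u_le P_le t_le.
have n_le : (n <= N)%N by rewrite /N; lia.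
have m_le : (m <= N)%N by rewrite /N; lia.
have N_gt0 : (0 < N)%N by [].
have nm_le : (n * m <= N ^ 2)%N by rewrite -mulnn leq_mul.
have N2 : (N <= N ^ 2)%N by rewrite -mulnn leq_pmulr.
have N24 : (N ^ 2 <= N ^ 4)%N by rewrite leq_pexp2l.
(* The 9 comes from 2m(n + 3) <= 6N^2 and 3 <= 3N^2. *)
have P_le' : (P * (m * (2 * n + 6) + 3) <= N ^ 2 * (9 * N ^ 2))%N.
  apply: leq_mul; first exact: leq_trans P_le nm_le.
  have : (m * (n + 3) <= 3 * N ^ 2)%N.
    rewrite -mulnn mulnCA leq_mul // /N; lia.
  lia.
have -> : (N ^ 4 = N ^ 2 * N ^ 2)%N by rewrite -expnD.
have u_le' : (m * (n + 4) <= 5 * N ^ 2)%N by lia.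
lia.
Qed.

Lemma returns_exists : exists t x, returns D H t x.
Proof.
suff run n t s : exec D H t s -> (#|I| * #|J| - \sum_j ptr s j < n)%N ->
    exists t x, returns D H t x.
  by apply: run (exec_init D H) (ltnSn _).
elim: n t s => // n IHn t s ex lt_n.
case E: (all_unsatisfied D s).2 => [|j us].
  by do 2!eexists; exact: (returns_alloc ex E).
have j_uns : j \in (all_unsatisfied D s).2 by rewrite E mem_head.
have ex' := exec_iter ex j_uns; apply: (IHn _ _ ex').
(* The pointer bound at the next state shows that the truncated difference was positive, hence
   strictly decreases. *)
by have := exec_sum_ptr ex'; rewrite advance_ptr sum_bump_ptr; lia.
Qed.

(** * Minimality of the reached prefixes *)

Lemma exec_prefix_least t s (S : J -> {set I}) : exec D H t s ->
  (forall j, exists k, S j = [set i in take k (pref D j)]) ->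
  (forall j, S j = [set: I] \/
     (demand D j)%:R <= \sum_i policy_alloc S i j) ->
  forall j, prefix_set (ptr s) j \subset S j.
Proof.
move=> ex S_prefix S_dem; elim: ex => [j|{}t {}s j ex IHs].
  by apply/subsetP => i; rewrite inE take0.
rewrite mem_all_unsatisfied advance_ptr => /andP[short p_lt] k.
have [->|k_neq] := eqVneq k j; last first.
  by rewrite /prefix_set /bump_ptr (negPf k_neq); apply: IHs.
have [l Sl] := S_prefix j.
have sub_take m m' : (m <= m')%N -> {subset take m (pref D j) <= take m' (pref D j)}.
  by move=> le_m i; rewrite -(take_takel _ le_m); apply: mem_take.
rewrite Sl; case: (ltnP (ptr s j) l) => [p_l|l_p].
  by apply/subsetP => i; rewrite !inE /bump_ptr eqxx; apply: sub_take.
have sSj : {subset S j <= prefix_set (ptr s) j}.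
  by move=> i; rewrite Sl !inE; apply: sub_take.
(* Now [S j] lies within the current prefix. It cannot be full, as the next impression is missing;
   nor can it meet the demand, as [S] gives j no more than the current allocation, which falls
   short. *)
exfalso; case: (S_dem j) => [S_full|].
  have [x0 _] : exists x0 : I, true.
    by move: p_lt; case: (pickP I) => [x0|/eq_card0->] //; exists x0.
  by have := prefix_set_next x0 p_lt; rewrite sSj // S_full inE.
apply/negP; rewrite -ltNge; apply: le_lt_trans short.
apply: ler_sum => i _; rewrite (exec_alloc ex).
by apply: policy_alloc_subset => //; apply: sSj.
Qed.

(** * Fairness and efficiency of the returned allocation *)

Section Result.
Variables (t : nat) (s : state R I J).
Hypotheses (s_exec : exec D H t s) (s_final : (all_unsatisfied D s).2 = [::]).

Lemma result_satisfied j :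
  prefix_set (ptr s) j = [set: I] \/ (demand D j)%:R <= \sum_i alloc s i j.
Proof.
have := mem_all_unsatisfied s j; rewrite s_final in_nil.
move=> /esym/negbT; rewrite negb_and -leNgt -leqNgt => /orP[|p_ge]; first by right.
left; apply/setP => i.
by rewrite !inE take_oversize ?size_pref // mem_pref.
Qed.

Lemma result_fair : fair D H (alloc s).
Proof.
exists (prefix_set (ptr s)); split; last exact: result_satisfied.
  by move=> j; exists (ptr s j).
exact: exec_alloc s_exec.
Qed.

Lemma result_most_efficient : most_efficient D H (alloc s).
Proof.
have x_ge0 i j : 0 <= alloc s i j.
  by rewrite (exec_alloc s_exec) policy_alloc_ge0.
pose y i j := greedy (pref D j) (demand D j)%:R (alloc s ^~ j) i.
have y_take j k : \sum_(i <- take k (pref D j)) y i j =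
    Num.min (demand D j)%:R (\sum_(i <- take k (pref D j)) alloc s i j).
  by rewrite sum_greedy_take ?uniq_pref.
exists y.
  split=> [i j|j]; first by rewrite greedy_ge0 // greedy_le.
  by rewrite (sum_pref j) -[pref D j]take_size y_take ge_min lexx.
move=> x' y' [S [S_prefix x'E S_dem]] [y'_bnd y'_dem].
have S_dem' j : S j = [set: I] \/ (demand D j)%:R <= \sum_i policy_alloc S i j.
  by case: (S_dem j) => [|le_x']; [left|right; rewrite -(eq_bigr _ (fun i _ => x'E i j))].
have sub_S := exec_prefix_least s_exec S_prefix S_dem'.
have y'_ge0 i j : 0 <= y' i j by case/andP: (y'_bnd i j).
have y'_le i j : i \in prefix_set (ptr s) j -> y' i j <= alloc s i j.
  move=> i_p; case/andP: (y'_bnd i j) => _ /le_trans->//.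
  by rewrite x'E (exec_alloc s_exec) policy_alloc_subset.
(* With the sums exchanged, each advertiser is compared separately, along its own preference
   order. *)
rewrite /efficiency exchange_big [leRHS]exchange_big /=.
apply: ler_sum => j _; rewrite !(sum_pref j).
apply: ler_sum_weighted_prefix => [||k].
- exact: pref_sorted.
- by move=> i; apply: weight_ge0.
have take_le (f : I -> R) : (forall i, 0 <= f i) ->
    \sum_(i <- take k (pref D j)) f i <= \sum_i f i.
  move=> f_ge0; rewrite (sum_pref j) -[X in _ <= \sum_(i <- X) _](cat_take_drop k).
  by rewrite big_cat lerDl sumr_ge0.
rewrite y_take le_min; apply/andP; split.
  by apply: le_trans (take_le _ _) (y'_dem j) => i; apply: y'_ge0.
(* Partial sums of [y'] are compared with those of [alloc s]: termwise by [y'_le] inside the final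
   prefix, and through the demand once k passes the pointer. *)
have [p_full|dem_le] := result_satisfied j.
  by apply: ler_sum => i _; rewrite y'_le // p_full inE.
case: (leqP k (ptr s j)) => [k_p|/ltnW p_k].
  rewrite big_seq [leRHS]big_seq; apply: ler_sum => i i_k.
  by rewrite y'_le // inE; move: i_k; rewrite -(take_takel _ k_p); apply: mem_take.
apply: le_trans (take_le (y' ^~ j) (y'_ge0 ^~ j)) _.
apply: le_trans (y'_dem j) _; apply: le_trans dem_le _.
(* Beyond the pointer the allocation vanishes. *)
rewrite (sum_pref j) -[X in \sum_(i <- X) _ <= _](cat_take_drop k) big_cat /=.
rewrite gerDl [leLHS]big_seq big1 // => i i_k.
rewrite (exec_alloc s_exec) /policy_alloc ifN // !inE.
have := uniq_pref j; rewrite -{1}(cat_take_drop k (pref D j)) cat_uniq.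
move=> /and3P[_ /hasPn/(_ _ i_k) i_nk _]; apply: contra i_nk.
by rewrite -(take_takel _ p_k); apply: mem_take.
Qed.

End Result.

End FairAllocation.

Theorem theorem11 :
  exists c d : nat,
  forall (R : realFieldType) (I J : finType)
         (D : instance R I J) (H : policy R I J),
  nonincreasing_policy H ->
  [/\ forall (t : nat) (s : state R I J),
        exec D H t s -> t <= c * (#|I| + #|J|).+1 ^ d,
      exists (t : nat) (x : I -> J -> R), returns D H t x
    & forall (t : nat) (x : I -> J -> R), returns D H t x ->
        [/\ t <= c * (#|I| + #|J|).+1 ^ d, fair D H x & most_efficient D H x]].
Proof.
exists 12, 4 => R I J D H H_mono; split.
- by move=> t s ex; apply: leq_trans (leq_addr _ _) (exec_poly ex).
- exact: returns_exists.
move=> _ _ [t s ex fin]; split.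
- exact: exec_poly ex.
- exact: result_fair ex fin.
- exact: result_most_efficient ex fin.
Qed.
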